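(* Consider the complex 3-dimensional Novikov algebras $E_{1,\lambda}(\alpha)$ $(\lambda\in\mathbb{C}\setminus\{0\},\ \alpha\in\mathbb{C})$, $E_{2,\lambda}$ $(\lambda\in\mathbb{C}\setminus\{0\})$, $E_3$, $E_4$, $E_5(\beta)$ $(\beta\in\mathbb{C})$, $E_6$ and $A_1,\dots,A_{12}$ given by the products listed in the context. For $A$ in the first list (type $E_\lambda$, $\lambda\ne0$) and $1\le j\le12$, the algebra $A_j$ lies in $\partial O(A)$ if and only if $A_j$ is one of the algebras given for $A$ below: \begin{itemize} \item $A=E_{1,\lambda}(\alpha)$ with $\lambda\neq0$, $\alpha\neq-1$: $A_1, A_5$; \item $A=E_{1,\lambda}(-1)$ with $\lambda\neq0,1$: $A_1, A_5$; \item $A=E_{1,1}(-1)$: $A_1$; \item $A=E_{2,\lambda}$, $\lambda\neq0$: $A_1, A_5$; \item $A=E_3$: $A_1, A_5, A_9, A_{10}$; \item $A=E_4$: $A_1, A_5, A_9, A_{10}$; \item $A=E_5(\beta)$ with $\beta\neq-\tfrac12,-1$: $A_1, A_5, A_9, A_{10}$; \item $A=E_5(-\tfrac12)$: $A_1, A_5, A_9$; \item $A=E_5(-1)$: $A_1, A_5$; \item $A=E_6$: $A_1, A_5, A_9$. \end{itemize}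
   Context: A Novikov algebra over $\mathbb{C}$ is a complex vector space with a bilinear product satisfying $(x\cdot y)\cdot z-x\cdot(y\cdot z)=(y\cdot x)\cdot z-y\cdot(x\cdot z)$ and $(x\cdot y)\cdot z=(x\cdot z)\cdot y$ for all $x,y,z$. Fix a 3-dimensional complex vector space $V$ with basis $(e_1,e_2,e_3)$. The set of Novikov products on $V$, identified with their structure constants in $\mathbb{C}^{27}$, is an affine algebraic set, on which $GL_3(\mathbb{C})$ acts by $(g\circ\mu)(x,y)=g(\mu(g^{-1}x,g^{-1}y))$. For a 3-dimensional Novikov algebra $A$, $O(A)$ is the orbit of a structure representing $A$, $\overline{O(A)}$ its Zariski closure, and $\partial O(A)=\overline{O(A)}\setminus O(A)$; ''$B$ lies in $\partial O(A)$'' means that a structure representing $B$ lies in $\partial O(A)$. The algebras (basis $e_1,e_2,e_3$; products of basis vectors not listed are zero): $E_{1,\lambda}(\alpha)$: $e_1e_1=\alpha e_1$, $e_1e_2=(\alpha+1)e_2$, $e_1e_3=(\alpha+\lambda)e_3$, $e_2e_1=\alpha e_2$, $e_3e_1=\alpha e_3$. $E_{2,\lambda}$: $e_1e_1=-e_1+e_2$, $e_1e_3=(\lambda-1)e_3$, $e_2e_1=-e_2$, $e_3e_1=-e_3$. $E_3$: $e_1e_1=-\frac12e_1+e_3$, $e_1e_2=\frac12e_2$, $e_1e_3=e_2$, $e_2e_1=-\frac12e_2$, $e_3e_1=e_2-\frac12e_3$. $E_4$: $e_1e_1=-e_1+e_2$, $e_1e_3=-\frac12e_3$, $e_2e_1=-e_2$,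 $e_3e_1=-e_3$, $e_3e_3=e_2$. $E_5(\beta)$: $e_1e_1=\beta e_1$, $e_1e_2=(\beta+1)e_2$, $e_1e_3=(\beta+\frac12)e_3$, $e_2e_1=\beta e_2$, $e_3e_1=\beta e_3$, $e_3e_3=e_2$. $E_6$: $e_1e_1=-\frac12e_1$, $e_1e_2=\frac12e_2$, $e_1e_3=e_2$, $e_2e_1=-\frac12e_2$, $e_3e_1=e_2-\frac12e_3$. $A_1$: all products zero. $A_2$: $e_3e_3=e_3$. $A_3$: $e_2e_2=e_2$, $e_3e_3=e_3$. $A_4$: $e_1e_1=e_1$, $e_2e_2=e_2$, $e_3e_3=e_3$. $A_5$: $e_2e_2=e_1$. $A_6$: $e_2e_2=e_1$, $e_3e_3=e_3$. $A_7$: $e_1e_2=e_1$, $e_2e_1=e_1$, $e_2e_2=e_2$. $A_8$: $e_1e_2=e_1$, $e_2e_1=e_1$, $e_2e_2=e_2$, $e_3e_3=e_3$. $A_9$: $e_2e_3=e_1$, $e_3e_2=e_1$. $A_{10}$: $e_2e_3=e_1$, $e_3e_2=e_1$, $e_3e_3=e_2$. $A_{11}$: $e_1e_3=e_1$, $e_2e_3=e_2$, $e_3e_1=e_1$, $e_3e_2=e_2$, $e_3e_3=e_3$. $A_{12}$: $e_1e_3=e_1$, $e_2e_2=e_1$, $e_2e_3=e_2$, $e_3e_1=e_1$, $e_3e_2=e_2$, $e_3e_3=e_3$. *)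

(* Defs.v *)
From HB Require Import structures.
From mathcomp Require Import all_boot all_order all_algebra.
From mathcomp Require Import complex reals mpoly ring.

Set Implicit Arguments.
Unset Strict Implicit.
Unset Printing Implicit Defensive.

Import Order.TTheory GRing.Theory Num.Theory.
Local Open Scope ring_scope.

(* Structure constants of a bilinear product on V = 'cV[F]_3: mu (i, j, k) is
   the coefficient of the k-th basis vector in the product of the i-th and the
   j-th one. *)
Notation str_index := ('I_3 * 'I_3 * 'I_3)%type.
Notation structure F := {ffun str_index -> F}.

Definition mul (F : fieldType) (mu : structure F) (x y : 'cV[F]_3) : 'cV[F]_3 :=
  \col_k \sum_i \sum_j x i 0 * y j 0 * mu (i, j, k).

Definition novikov (F : fieldType) (mu : structure F) : Prop :=
  let m := mul mu in
  (forall x y z, m (m x y) z - m x (m y z) = m (m y x) z - m y (m x z)) /\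
  (forall x y z, m (m x y) z = m (m x z) y).

Definition gact (F : fieldType) (g : 'M[F]_3) (mu : structure F) : structure F :=
  [ffun t : str_index =>
     (g *m mul mu (invmx g *m delta_mx t.1.1 0)
                  (invmx g *m delta_mx t.1.2 0)) t.2 0].

Definition orbit (F : fieldType) (mu nu : structure F) : Prop :=
  exists2 g : 'M[F]_3, g \in unitmx & nu = gact g mu.

(* The affine space F^27, with coordinates numbered by enum_rank : str_index ->
   'I_#|{: str_index}|. *)
Notation str_poly F := {mpoly F[#|{: str_index}|]}.

Definition str_eval (F : fieldType) (mu : structure F) (p : str_poly F) : F :=
  p.@[fun m => mu (enum_val m)].

Definition zariski_closed (F : fieldType) (Z : structure F -> Prop) : Prop :=
  exists I : str_poly F -> Prop,
    forall mu, Z mu <-> (forall p, I p -> str_eval mu p = 0).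

(* Closure of S for the topology that the set X inherits from F^27. *)
Definition zariski_closure_in (F : fieldType) (X S : structure F -> Prop)
    (mu : structure F) : Prop :=
  X mu /\ (forall Z, zariski_closed Z -> (forall nu, S nu -> Z nu) -> Z mu).

Definition orbit_closure (F : fieldType) (mu : structure F) :=
  zariski_closure_in (@novikov F) (orbit mu).

Definition orbit_boundary (F : fieldType) (mu nu : structure F) : Prop :=
  orbit_closure mu nu /\ ~ orbit mu nu.

(* The structures on V that represent the algebra (V, B) are those in the orbit
   of B. *)
Definition lies_in_boundary (F : fieldType) (B A : structure F) : Prop :=
  exists2 nu, orbit B nu & orbit_boundary A nu.

(* Multiplication tables: an entry (i, j, v) says that e_i e_j = v, with basis
   vectors numbered from 1; the products that are not listed are zero. *)
Definition e (F : fieldType) (i : nat) : 'cV[F]_3 :=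
  \col_(k < 3) (k.+1 == i)%:R.
Arguments e {F} i%_N.

Definition prd (F : fieldType) (i j : nat) (v : 'cV[F]_3) :
  nat * nat * 'cV[F]_3 := (i, j, v).
Arguments prd {F} (i j)%_N v%_R.

Definition of_table (F : fieldType) (s : seq (nat * nat * 'cV[F]_3)) :
    structure F :=
  [ffun t : str_index =>
     (\sum_(q <- s | q.1 == (t.1.1.+1, t.1.2.+1)) q.2) t.2 0].

Definition E1 (F : fieldType) (lambda alpha : F) : structure F := of_table
  [:: prd 1 1 (alpha *: e 1);
      prd 1 2 ((alpha + 1) *: e 2);
      prd 1 3 ((alpha + lambda) *: e 3);
      prd 2 1 (alpha *: e 2);
      prd 3 1 (alpha *: e 3)].

Definition E2 (F : fieldType) (lambda : F) : structure F := of_table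
  [:: prd 1 1 (- e 1 + e 2);
      prd 1 3 ((lambda - 1) *: e 3);
      prd 2 1 (- e 2);
      prd 3 1 (- e 3)].

Definition E3 (F : fieldType) : structure F := of_table
  [:: prd 1 1 (- (1 / 2) *: e 1 + e 3);
      prd 1 2 ((1 / 2) *: e 2);
      prd 1 3 (e 2);
      prd 2 1 (- (1 / 2) *: e 2);
      prd 3 1 (e 2 - (1 / 2) *: e 3)].

Definition E4 (F : fieldType) : structure F := of_table
  [:: prd 1 1 (- e 1 + e 2);
      prd 1 3 (- (1 / 2) *: e 3);
      prd 2 1 (- e 2);
      prd 3 1 (- e 3);
      prd 3 3 (e 2)].

Definition E5 (F : fieldType) (beta : F) : structure F := of_table
  [:: prd 1 1 (beta *: e 1);
      prd 1 2 ((beta + 1) *: e 2);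
      prd 1 3 ((beta + 1 / 2) *: e 3);
      prd 2 1 (beta *: e 2);
      prd 3 1 (beta *: e 3);
      prd 3 3 (e 2)].

Definition E6 (F : fieldType) : structure F := of_table
  [:: prd 1 1 (- (1 / 2) *: e 1);
      prd 1 2 ((1 / 2) *: e 2);
      prd 1 3 (e 2);
      prd 2 1 (- (1 / 2) *: e 2);
      prd 3 1 (e 2 - (1 / 2) *: e 3)].

(* Only the indices 1 to 12 are meaningful. *)
Definition A_table (F : fieldType) (j : nat) : seq (nat * nat * 'cV[F]_3) :=
  match j with
  | 1 => [::]
  | 2 => [:: prd 3 3 (e 3)]
  | 3 => [:: prd 2 2 (e 2); prd 3 3 (e 3)]
  | 4 => [:: prd 1 1 (e 1); prd 2 2 (e 2); prd 3 3 (e 3)]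
  | 5 => [:: prd 2 2 (e 1)]
  | 6 => [:: prd 2 2 (e 1); prd 3 3 (e 3)]
  | 7 => [:: prd 1 2 (e 1); prd 2 1 (e 1); prd 2 2 (e 2)]
  | 8 => [:: prd 1 2 (e 1); prd 2 1 (e 1); prd 2 2 (e 2); prd 3 3 (e 3)]
  | 9 => [:: prd 2 3 (e 1); prd 3 2 (e 1)]
  | 10 => [:: prd 2 3 (e 1); prd 3 2 (e 1); prd 3 3 (e 2)]
  | 11 => [:: prd 1 3 (e 1); prd 2 3 (e 2); prd 3 1 (e 1); prd 3 2 (e 2);
              prd 3 3 (e 3)]
  | 12 => [:: prd 1 3 (e 1); prd 2 2 (e 1); prd 2 3 (e 2); prd 3 1 (e 1);
              prd 3 2 (e 2); prd 3 3 (e 3)]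
  | _ => [::]
  end%N.

Definition A (F : fieldType) (j : nat) : structure F := of_table (A_table F j).

Lemma card_str_index : #|{: str_index}| = 27%N.
Proof. by rewrite !card_prod card_ord. Qed.

Lemma mul_suml (F : fieldType) (mu : structure F) (a : 'I_3 -> F) u y :
  mul mu (\sum_i a i *: u i) y = \sum_i a i *: mul mu (u i) y.
Proof.
apply/colP => k; rewrite !mxE summxE.
under [RHS]eq_bigr => l _ do rewrite !mxE mulr_sumr.
rewrite [RHS]exchange_big; apply: eq_bigr => i _ /=.
under [RHS]eq_bigr => l _ do rewrite mulr_sumr.
rewrite [RHS]exchange_big; apply: eq_bigr => j _ /=.
by rewrite summxE !mulr_suml; apply: eq_bigr => l _; rewrite mxE !mulrA.
Qed.

Lemma mul_sumr (F : fieldType) (mu : structure F) x (a : 'I_3 -> F) u :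
  mul mu x (\sum_i a i *: u i) = \sum_i a i *: mul mu x (u i).
Proof.
apply/colP => k; rewrite !mxE summxE.
under [RHS]eq_bigr => l _ do rewrite !mxE mulr_sumr.
rewrite [RHS]exchange_big; apply: eq_bigr => i _ /=.
under [RHS]eq_bigr => l _ do rewrite mulr_sumr.
rewrite [RHS]exchange_big; apply: eq_bigr => j _ /=.
rewrite summxE mulr_sumr mulr_suml; apply: eq_bigr => l _.
by rewrite mxE !mulrA (mulrC (x i 0)).
Qed.

Lemma mul_delta (F : fieldType) (mu : structure F) i j k :
  mul mu (delta_mx i 0) (delta_mx j 0) k 0 = mu (i, j, k).
Proof.
rewrite mxE (bigD1 i) //= (bigD1 j) //= !mxE !eqxx !mul1r !big1 ?addr0 //.
  by move=> i' /negPf ne; rewrite big1 // => j' _; rewrite !mxE ne !mul0r.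
by move=> j' /negPf ne; rewrite !mxE ne mulr0 mul0r.
Qed.

Lemma mul_gact (F : fieldType) (g : 'M[F]_3) (mu : structure F) x y :
  mul (gact g mu) x y = g *m mul mu (invmx g *m x) (invmx g *m y).
Proof.
have sumd (z : 'cV[F]_3) : z = \sum_i z i 0 *: delta_mx i 0.
  by rewrite [LHS]matrix_sum_delta; apply: eq_bigr => i _; rewrite big_ord1.
have sumg (z : 'cV[F]_3) :
    invmx g *m z = \sum_i z i 0 *: (invmx g *m delta_mx i 0).
  rewrite {1}(sumd z) mulmx_sumr.
  by apply: eq_bigr => i _; rewrite scalemxAr.
rewrite {1}(sumd x) (sumg x) !mul_suml mulmx_sumr; apply: eq_bigr => i _.
rewrite -scalemxAr; congr (_ *: _).
rewrite {1}(sumd y) (sumg y) !mul_sumr mulmx_sumr; apply: eq_bigr => j _.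
rewrite -scalemxAr; congr (_ *: _).
by apply/colP => k; rewrite mul_delta ffunE.
Qed.

Definition coord1 (F : fieldType) (z : 'cV[F]_3) (a : nat) : F :=
  \sum_(i < 3 | i.+1 == a) z i 0.

Lemma coord1D (F : fieldType) (u v : 'cV[F]_3) a :
  coord1 (u + v) a = coord1 u a + coord1 v a.
Proof. by rewrite -big_split; apply: eq_bigr => i _; rewrite mxE. Qed.

Lemma coord1N (F : fieldType) (u : 'cV[F]_3) a : coord1 (- u) a = - coord1 u a.
Proof. by rewrite -sumrN; apply: eq_bigr => i _; rewrite mxE. Qed.

Lemma coord1Z (F : fieldType) (c : F) (u : 'cV[F]_3) a :
  coord1 (c *: u) a = c * coord1 u a.
Proof. by rewrite /coord1 mulr_sumr; apply: eq_bigr => i _; rewrite mxE. Qed.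

Lemma coord1_0 (F : fieldType) a : coord1 (0 : 'cV[F]_3) a = 0.
Proof. by rewrite /coord1 big1 // => i _; rewrite mxE. Qed.

Lemma coord1_e (F : fieldType) a b :
  coord1 (e b : 'cV[F]_3) a = ((a == b) && (0 < a <= 3)%N)%:R.
Proof.
rewrite /coord1; under eq_bigr => i /eqP ia do rewrite mxE ia.
rewrite !big_mkcond !big_ord_recr big_ord0 /=.
by case: a => [|[|[|[|a]]]] /=; rewrite ?andbF ?andbT ?(addr0, add0r).
Qed.

Lemma coord1P (F : fieldType) (u v : 'cV[F]_3) :
  coord1 u 1 = coord1 v 1 -> coord1 u 2 = coord1 v 2 ->
  coord1 u 3 = coord1 v 3 -> u = v.
Proof.
have cE (z : 'cV[F]_3) (i : 'I_3) : coord1 z i.+1 = z i 0.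
  by rewrite /coord1 (eq_bigl (pred1 i)) ?big_pred1_eq.
move=> e1 e2 e3; apply/colP => i; rewrite -!cE.
by case: i => [[|[|[|//]]] ?].
Qed.

Lemma mul_of_table (F : fieldType) s (x y : 'cV[F]_3) :
  mul (of_table s) x y =
  \sum_(q <- s) (coord1 x q.1.1 * coord1 y q.1.2) *: q.2.
Proof.
apply/colP => k; rewrite summxE mxE.
under eq_bigr => i _ do under eq_bigr => j _ do
  rewrite ffunE /= summxE big_mkcond mulr_sumr.
under eq_bigr => i _ do rewrite exchange_big.
rewrite exchange_big; apply: eq_bigr => -[[a b] v] _ /=.
rewrite mxE /coord1 !(big_mkcond (fun i : 'I_3 => _.+1 == _)) mulr_suml mulr_suml.
apply: eq_bigr => i _; rewrite mulr_sumr mulr_suml; apply: eq_bigr => j _.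
rewrite xpair_eqE ![_ == _.+1]eq_sym.
by case: (_ == a); case: (_ == b); rewrite /= ?(mulr0, mul0r).
Qed.

Lemma coord1_mul (F : fieldType) s (x y : 'cV[F]_3) a :
  coord1 (mul (of_table s) x y) a =
  \sum_(q <- s) coord1 x q.1.1 * coord1 y q.1.2 * coord1 q.2 a.
Proof.
rewrite mul_of_table; elim: s => [|q s IH].
  by rewrite !big_nil coord1_0.
by rewrite !big_cons coord1D coord1Z IH.
Qed.

Ltac coord1_tac F mu a H :=
  eassert (H : forall u v : 'cV[F]_3, coord1 (mul mu u v) a = _);
  [ intros u v; rewrite coord1_mul !(big_cons, big_nil) /=;
    rewrite ?(coord1D, coord1N, coord1Z, coord1_0, coord1_e) /=;
    rewrite ?(mulr0, mul0r, addr0, add0r, mulr1, oppr0, subr0); reflexivity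
  | cbn beta in H ].

Ltac novikov_tac :=
  match goal with |- @novikov ?F ?m =>
    let mu := fresh "mu" in
    pose mu := m; change (novikov mu);
    let H1 := fresh in coord1_tac F mu 1%N H1;
    let H2 := fresh in coord1_tac F mu 2%N H2;
    let H3 := fresh in coord1_tac F mu 3%N H3;
    rewrite /novikov; clearbody mu;
    split=> x y z; apply: coord1P; rewrite ?(coord1D, coord1N) !(H1, H2, H3);
    by field
  end.

Lemma E1_novikov (F : numFieldType) (lambda alpha : F) :
  novikov (E1 lambda alpha).
Proof. novikov_tac. Qed.

Lemma E2_novikov (F : numFieldType) (lambda : F) : novikov (E2 lambda).
Proof. novikov_tac. Qed.

Lemma E3_novikov (F : numFieldType) : novikov (E3 F).
Proof. novikov_tac. Qed.

Lemma E4_novikov (F : numFieldType) : novikov (E4 F).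
Proof. novikov_tac. Qed.

Lemma E5_novikov (F : numFieldType) (beta : F) : novikov (E5 beta).
Proof. novikov_tac. Qed.

Lemma E6_novikov (F : numFieldType) : novikov (E6 F).
Proof. novikov_tac. Qed.

Lemma A_novikov (F : numFieldType) (j : nat) : novikov (A F j).
Proof.
by do 13?[case: j => [|j]; first by rewrite /A /=; novikov_tac];
  rewrite /A /=; novikov_tac.
Qed.

Lemma gact_novikov (F : fieldType) (g : 'M[F]_3) (mu : structure F) :
  g \in unitmx -> novikov mu -> novikov (gact g mu).
Proof.
move=> ug [lsym rcom]; split=> x y z; rewrite !mul_gact !mulKmx // -?mulmxBr.
  by rewrite lsym.
by rewrite rcom.
Qed.

(* Main.v *)
Require Import Defs.
From HB Require Import structures.
From mathcomp Require Import all_boot all_order all_algebra.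
From mathcomp Require Import complex reals mpoly ring.
Import Defs.

Set Implicit Arguments.
Unset Strict Implicit.
Unset Printing Implicit Defensive.

Import Order.TTheory GRing.Theory Num.Theory.
Local Open Scope ring_scope.
Local Open Scope complex_scope.

(** Write f for the first coordinate, L_x and R_x for the left and right
multiplications.  In each algebra of type E, the trace of R_x is a constant
multiple c f(x), and [x, e_2] = f(x) e_2.

Non-degenerations.  A polynomial condition that is invariant under base change
and holds in E passes to the closure of its orbit ([boundary_closed]).
- By the above, c (L_x - R_x) - tr(R_x) kills e_2, so its determinant vanishes.
  In a commutative limit the determinant is - tr(R_x)^3, so the limit must have
  tr R = 0; this leaves A_1, A_5, A_9, A_10 ([boundary_candidates]).
- The residual product 3 xy - tr(R_y) x is a tensor in V* (x) V* (x) V which, for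
  some of the E, splits off one of its three factors: it is f(x) B(y), or
  g(y) B(x), or q(x, y) u.  Being split along a given factor is a rank one
  condition, hence given by quadrics, the exchange relations ([exchange]).  In
  A_5, A_9, A_10 the residual is 3 times the product.  As a symmetric bilinear
  map, the product of A_9 or A_10 cannot split off a linear form without being
  of the form f(x) f(y) u, which it is not; and that of A_10 takes values in a
  plane, not in a line.  For E_{1,1}(-1) the residual is even zero.

Degenerations.  Rescale a basis of E by powers of t given by integer weights.  If
a product of basis vectors only involves vectors of weight at most the sum of
the two weights, this one-parameter family in the orbit has a limit at t = 0,
the associated graded algebra ([graded_in_closure]).
- A_1 comes from weights (1, 1, 1).
- A_5 comes from any v such that v and v^2 are independent ([A5_limit]).
- A_9 comes from a plane U on which the product induces a symmetric,
  nondegenerate form with values in V / U; the basis of U is isotropic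
  ([A9_limit]).
- A_10 comes from a flag: v, then the plane spanned by v and v^2, on which v is
  isotropic for the form above ([A10_limit]).
Where the last two limits exist, U is spanned by e_1 + a e_2 and e_3 for a
suitable a; it is closed under commutators, which makes the form symmetric, and
e_2 spans a complement.

Conversely none of the A_j is isomorphic to an algebra of type E, since the A_j
are commutative and [e_1, e_2] = e_2 in E. *)

(** * Orbits and invariant closed conditions *)

Lemma gactK (F : fieldType) (g : 'M[F]_3) (mu : structure F) :
  g \in unitmx -> gact (invmx g) (gact g mu) = mu.
Proof.
move=> ug; apply/ffunP => -[[i j] k].
by rewrite ffunE mul_gact invmxK !mulKmx // mul_delta.
Qed.

Lemma orbit_refl (F : fieldType) (mu : structure F) : orbit mu mu.
Proof.
exists 1%:M; first exact: unitmx1.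
apply/ffunP => -[[i j] k].
by rewrite ffunE invmx1 !mul1mx mul_delta.
Qed.

Definition invariant (F : fieldType) (P : structure F -> Prop) : Prop :=
  forall (g : 'M[F]_3) mu, g \in unitmx -> P mu -> P (gact g mu).

(** The principle behind all the negative statements: the orbit of A satisfies P by
invariance, its closure because P is closed, and then B by invariance again,
since the structure in the closure is only isomorphic to B. *)
Lemma boundary_closed (F : fieldType) (P : structure F -> Prop)
    (B A : structure F) :
  invariant P -> zariski_closed P -> P A -> lies_in_boundary B A -> P B.
Proof.
move=> invP clP PA [_ [g ug ->] [[_ clo] _]].
rewrite -(gactK B ug); apply: (invP _ _ _); first by rewrite unitmx_inv.
by apply: clo => // _ [h uh ->]; apply: invP.
Qed.

(** Regular functions on the space of structures; closing them under the ring
operations avoids writing down the polynomials that define a closed set. *)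
Definition polynomial_fun (F : fieldType) (f : structure F -> F) : Prop :=
  exists p : str_poly F, forall mu, str_eval mu p = f mu.

Section PolynomialFun.
Variable F : fieldType.
Implicit Types f g : structure F -> F.

Lemma polynomial_cst (c : F) : polynomial_fun (fun=> c).
Proof. by exists c%:MP => mu; rewrite /str_eval mevalC. Qed.

Lemma polynomial_coord t : polynomial_fun (fun mu : structure F => mu t).
Proof.
by exists 'X_(enum_rank t) => mu; rewrite /str_eval mevalXU enum_rankK.
Qed.

Lemma polynomialD f g :
  polynomial_fun f -> polynomial_fun g -> polynomial_fun (fun mu => f mu + g mu).
Proof.
move=> [p pE] [q qE]; exists (p + q) => mu.
by rewrite -pE -qE /str_eval mevalD.
Qed.

Lemma polynomialM f g :
  polynomial_fun f -> polynomial_fun g -> polynomial_fun (fun mu => f mu * g mu).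
Proof.
move=> [p pE] [q qE]; exists (p * q) => mu.
by rewrite -pE -qE /str_eval mevalM.
Qed.

Lemma polynomialN f : polynomial_fun f -> polynomial_fun (fun mu => - f mu).
Proof.
by move=> [p pE]; exists (- p) => mu; rewrite -pE /str_eval mevalN.
Qed.

Lemma polynomial_sum (I : Type) (r : seq I) (f : I -> structure F -> F) :
  (forall i, polynomial_fun (f i)) ->
  polynomial_fun (fun mu => \sum_(i <- r) f i mu).
Proof.
move=> fP; elim: r => [|i r [p pE]].
  by exists 0 => mu; rewrite big_nil /str_eval meval0.
have [q qE] := fP i; exists (q + p) => mu.
by rewrite big_cons -pE -qE /str_eval mevalD.
Qed.

Lemma polynomial_prod (I : Type) (r : seq I) (f : I -> structure F -> F) :
  (forall i, polynomial_fun (f i)) ->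
  polynomial_fun (fun mu => \prod_(i <- r) f i mu).
Proof.
move=> fP; elim: r => [|i r [p pE]].
  by exists 1 => mu; rewrite big_nil /str_eval meval1.
have [q qE] := fP i; exists (q * p) => mu.
by rewrite big_cons -pE -qE /str_eval mevalM.
Qed.

Lemma polynomial_ext f g : f =1 g -> polynomial_fun f -> polynomial_fun g.
Proof. by move=> fg [p pE]; exists p => mu; rewrite pE fg. Qed.

Lemma polynomial_det n (M : structure F -> 'M[F]_n) :
  (forall i j, polynomial_fun (fun mu => M mu i j)) ->
  polynomial_fun (fun mu => \det (M mu)).
Proof.
move=> MP; apply: polynomial_sum => s.
by apply: polynomialM; [exact: polynomial_cst | exact: polynomial_prod].
Qed.

Lemma polynomial_mul x y k : polynomial_fun (fun mu : structure F => mul mu x y k 0).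
Proof.
apply: (@polynomial_ext
          (fun mu : structure F => \sum_i \sum_j x i 0 * y j 0 * mu (i, j, k))).
  by move=> mu; rewrite mxE.
do 2!apply: polynomial_sum => ?.
by apply: polynomialM; [exact: polynomial_cst | exact: polynomial_coord].
Qed.

Lemma closed_zeros (I : Type) (f : I -> structure F -> F) :
  (forall i, polynomial_fun (f i)) ->
  zariski_closed (fun mu => forall i, f i mu = 0).
Proof.
move=> fP; exists (fun p => exists i, forall mu, str_eval mu p = f i mu) => mu.
split=> [f0 p [i ->]//|van i].
by have [p pE] := fP i; rewrite -pE; apply: van; exists i.
Qed.

End PolynomialFun.

(** * The conditions that obstruct degenerations *)

Section Obstructions.
Variable F : fieldType.
Implicit Types mu : structure F.

Definition lmx mu (x : 'cV[F]_3) : 'M[F]_3 :=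
  \matrix_(i, j) mul mu x (delta_mx j 0) i 0.

Definition rmx mu (x : 'cV[F]_3) : 'M[F]_3 :=
  \matrix_(i, j) mul mu (delta_mx j 0) x i 0.

Definition rtr mu x : F := \tr (rmx mu x).

Lemma col_sum_delta (x : 'cV[F]_3) : x = \sum_j x j 0 *: delta_mx j 0.
Proof. by rewrite [LHS]matrix_sum_delta; apply: eq_bigr => i _; rewrite big_ord1. Qed.

Lemma mul_lmx mu x y : lmx mu x *m y = mul mu x y.
Proof.
rewrite [in RHS](col_sum_delta y) mul_sumr; apply/colP => i.
by rewrite mxE summxE; apply: eq_bigr => j _; rewrite !mxE mulrC.
Qed.

Lemma mul_rmx mu x y : rmx mu x *m y = mul mu y x.
Proof.
rewrite [in RHS](col_sum_delta y) mul_suml; apply/colP => i.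
by rewrite mxE summxE; apply: eq_bigr => j _; rewrite !mxE mulrC.
Qed.

Lemma mx_ext (M N : 'M[F]_3) : (forall y : 'cV_3, M *m y = N *m y) -> M = N.
Proof.
by move=> MN; apply/matrixP => i j; have := MN (delta_mx j 0);
  rewrite -!colE => /colP/(_ i); rewrite !mxE.
Qed.

Lemma lmx_gact (g : 'M[F]_3) mu x :
  lmx (gact g mu) x = g *m lmx mu (invmx g *m x) *m invmx g.
Proof. by apply: mx_ext => y; rewrite mul_lmx mul_gact -!mulmxA mul_lmx. Qed.

Lemma rmx_gact (g : 'M[F]_3) mu x :
  rmx (gact g mu) x = g *m rmx mu (invmx g *m x) *m invmx g.
Proof. by apply: mx_ext => y; rewrite mul_rmx mul_gact -!mulmxA mul_rmx. Qed.

Lemma rtr_gact (g : 'M[F]_3) mu x :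
  g \in unitmx -> rtr (gact g mu) x = rtr mu (invmx g *m x).
Proof. by move=> ug; rewrite /rtr rmx_gact mxtrace_mulC mulKmx. Qed.

(** When tr R_x = c f(x), this says that f(x) is an eigenvalue of
ad x = L_x - R_x.  Multiplying through by c keeps the condition polynomial and
lets it say something about limits in which f has been rescaled to 0. *)
Definition weight_cond (c : F) mu : Prop := forall x,
  \det (c *: (lmx mu x - rmx mu x) - (rtr mu x)%:M) = 0.

Lemma weight_cond_invariant c : invariant (weight_cond c).
Proof.
move=> g mu ug mu0 x; rewrite rtr_gact // lmx_gact rmx_gact.
set y := invmx g *m x.
have -> : (rtr mu y)%:M = g *m (rtr mu y)%:M *m invmx g.
  by rewrite scalar_mxC -mulmxA mulmxV ?mulmx1.
rewrite -mulmxBl -mulmxBr scalemxAl scalemxAr -mulmxBl -mulmxBr.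
by rewrite !det_mulmx mu0 mulr0 mul0r.
Qed.

Lemma polynomial_lmx x i j : polynomial_fun (fun mu => lmx mu x i j).
Proof.
by apply: (polynomial_ext _ (polynomial_mul x (delta_mx j 0) i)) => mu; rewrite [RHS]mxE.
Qed.

Lemma polynomial_rmx x i j : polynomial_fun (fun mu => rmx mu x i j).
Proof.
by apply: (polynomial_ext _ (polynomial_mul (delta_mx j 0) x i)) => mu; rewrite [RHS]mxE.
Qed.

Lemma polynomial_rtr x : polynomial_fun (fun mu => rtr mu x).
Proof. by apply: polynomial_sum => i; exact: polynomial_rmx. Qed.

Lemma weight_cond_closed c : zariski_closed (weight_cond c).
Proof.
apply: closed_zeros => x; apply: polynomial_det => i j.
apply: (@polynomial_ext _ (fun mu =>
   c * (lmx mu x i j + - rmx mu x i j) + - (rtr mu x * (i == j)%:R))).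
  by move=> mu; rewrite !mxE mulr_natr.
apply: polynomialD; last first.
  apply/polynomialN/polynomialM; last exact: polynomial_cst.
  exact: polynomial_rtr.
apply: polynomialM; first exact: polynomial_cst.
by apply: polynomialD; [|apply: polynomialN];
  [exact: polynomial_lmx | exact: polynomial_rmx].
Qed.

Definition commutative_str mu : Prop := forall x y, mul mu x y = mul mu y x.

Lemma commutative_invariant : invariant commutative_str.
Proof. by move=> g mu ug com x y; rewrite !mul_gact com. Qed.

(** If ad x = 0, the determinant is (- tr R_x)^3. *)
Lemma weight_cond_commutative c mu x :
  commutative_str mu -> weight_cond c mu -> rtr mu x = 0.
Proof.
move=> com /(_ x); have -> : lmx mu x = rmx mu x.
  by apply: mx_ext => y; rewrite mul_lmx mul_rmx com.
rewrite subrr scaler0 sub0r -scalemx1 -scaleNr detZ det1 mulr1.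
by move/eqP; rewrite expf_eq0 /= oppr_eq0 => /eqP.
Qed.

(** In type E every R_y has the single eigenvalue tr(R_y) / 3; subtracting it
leaves a product with few nonzero entries, and the factor 3 clears the
denominator. *)
Definition residual mu x y : 'cV[F]_3 := 3 *: mul mu x y - rtr mu y *: x.

Lemma residual_gact (g : 'M[F]_3) mu x y : g \in unitmx ->
  residual (gact g mu) x y = g *m residual mu (invmx g *m x) (invmx g *m y).
Proof.
move=> ug; rewrite /residual mul_gact rtr_gact // mulmxBr -!scalemxAr.
by rewrite mulKVmx.
Qed.

Lemma polynomial_residual x y i : polynomial_fun (fun mu => residual mu x y i 0).
Proof.
apply: (@polynomial_ext _ (fun mu =>
   3 * mul mu x y i 0 + - (rtr mu y * x i 0))).
  move=> mu; rewrite /residual [RHS]mxE; congr (_ + _); first by rewrite [RHS]mxE.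
  by rewrite [RHS]mxE; congr (- _); rewrite [RHS]mxE.
apply: polynomialD.
  by apply: polynomialM; [exact: polynomial_cst | exact: polynomial_mul].
apply/polynomialN/polynomialM; last exact: polynomial_cst.
exact: polynomial_rtr.
Qed.

(** The 2x2 minors of a flattening of the residual tensor: exchanging the left
arguments tests whether the left factor splits off, exchanging the right
arguments tests the right factor, and exchanging both is the same as exchanging
the values, which tests the third factor. *)
Definition exchange (l r : bool) mu : Prop := forall x y z w,
  residual mu x y *m (residual mu z w)^T =
  residual mu (if l then z else x) (if r then w else y) *m
    (residual mu (if l then x else z) (if r then y else w))^T.

Lemma exchange_invariant l r : invariant (exchange l r).
Proof.
move=> g mu ug ex x y z w; rewrite !residual_gact // !trmx_mul !mulmxA.
congr (_ *m _); rewrite -!mulmxA; congr (_ *m _); rewrite ex.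
by case: (l); case: (r).
Qed.

Lemma polynomial_residual_mx x y z w i j :
  polynomial_fun (fun mu => (residual mu x y *m (residual mu z w)^T) i j).
Proof.
apply: (@polynomial_ext _ (fun mu => residual mu x y i 0 * residual mu z w j 0)).
  by move=> mu; rewrite !mxE big_ord1 !mxE.
by apply: polynomialM; exact: polynomial_residual.
Qed.

Lemma exchange_closed l r : zariski_closed (exchange l r).
Proof.
(* One scalar equation for each choice of arguments and entry. *)
have [I IE] : zariski_closed (fun mu =>
  forall t : 'cV[F]_3 * 'cV[F]_3 * 'cV[F]_3 * 'cV[F]_3 * 'I_3 * 'I_3,
  (let: (x, y, z, w, i, j) := t in
  (residual mu x y *m (residual mu z w)^T) i j -
  (residual mu (if l then z else x) (if r then w else y) *m
    (residual mu (if l then x else z) (if r then y else w))^T) i j) = 0).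
  apply: closed_zeros => -[[[[[x y] z] w] i] j].
  by apply: polynomialD; [|apply: polynomialN]; exact: polynomial_residual_mx.
exists I => mu; rewrite -IE; split=> [ex [[[[[x y] z] w] i] j]|ex x y z w].
  by rewrite ex subrr.
apply/matrixP => i j; apply/eqP.
by rewrite -subr_eq0 (ex (x, y, z, w, i, j)).
Qed.

Definition residual_free mu : Prop := forall x y, residual mu x y = 0.

Lemma residual_free_invariant : invariant residual_free.
Proof. by move=> g mu ug mu0 x y; rewrite residual_gact // mu0 mulmx0. Qed.

Lemma residual_free_closed : zariski_closed residual_free.
Proof.
have [I IE] : zariski_closed (fun mu =>
    forall t : 'cV[F]_3 * 'cV[F]_3 * 'I_3, residual mu t.1.1 t.1.2 t.2 0 = 0).
  by apply: closed_zeros => t; exact: polynomial_residual.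
exists I => mu; rewrite -IE; split=> [mu0 t|mu0 x y]; first by rewrite mu0 mxE.
by apply/colP => i; rewrite (mu0 (x, y, i)) mxE.
Qed.

End Obstructions.

(** * Degenerations *)

Section Degenerations.
Variable F : numFieldType.
Implicit Types mu nu : structure F.

Lemma mulZ mu a b (x y : 'cV[F]_3) :
  mul mu (a *: x) (b *: y) = (a * b) *: mul mu x y.
Proof. by rewrite -mul_lmx -scalemxAr mul_lmx -mul_rmx -scalemxAr mul_rmx scalerA mulrC. Qed.

(** Characteristic 0 supplies infinitely many nonzero points. *)
Lemma poly_eq0_off0 (p : {poly F}) : (forall t, t != 0 -> p.[t] = 0) -> p = 0.
Proof.
move=> p0; apply/eqP; apply: contraT => nz.
have := @max_poly_roots _ p [seq i.+1%:R | i <- iota 0 (size p)] nz.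
rewrite size_map size_iota ltnn => ->//.
  by apply/allP => _ /mapP[i _ ->]; apply/rootP/p0; rewrite pnatr_eq0.
by rewrite map_inj_uniq ?iota_uniq // => i k /eqP; rewrite eqr_nat => /eqP[].
Qed.

(** A polynomial that vanishes on the orbit vanishes along the curve for t <> 0; as
a polynomial in t it is then zero, so it vanishes at t = 0 too. *)
Lemma limit_in_closure mu (q : str_index -> {poly F}) :
  novikov [ffun s => (q s).[0]] ->
  (forall t, t != 0 -> orbit mu [ffun s => (q s).[t]]) ->
  orbit_closure mu [ffun s => (q s).[0]].
Proof.
move=> nov curve; split=> // Z [I IE] sub; apply/IE => p Ip.
pose P := \sum_(m <- msupp p) p@_m *: \prod_i q (enum_val i) ^+ m i.
have PE t : P.[t] = str_eval [ffun s => (q s).[t]] p.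
  rewrite /str_eval mevalE horner_sum; apply: eq_bigr => m _.
  rewrite hornerZ horner_prod; congr (_ * _).
  by apply: eq_bigr => i _; rewrite horner_exp ffunE.
rewrite -PE (@poly_eq0_off0 P) ?horner0 // => t t0.
by rewrite PE; apply: (IE _).1 => //; apply/sub/curve.
Qed.

(** The columns of H are a basis, and rescaling its i-th vector by t^(w i)
multiplies the structure constant with indices i, j, k by
t^(w i + w j - w k).  If no constant with a negative exponent survives, the
family extends to t = 0, where exactly the constants with exponent 0 remain. *)
Lemma graded_in_closure mu nu (H K : 'M[F]_3) (w : 'I_3 -> nat) :
  novikov nu -> K *m H = 1%:M ->
  (forall i j k, (w i + w j <= w k)%N ->
     (K *m mul mu (H *m delta_mx i 0) (H *m delta_mx j 0)) k 0 = nu (i, j, k)) ->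
  (forall i j k, (w i + w j)%N != w k -> nu (i, j, k) = 0) ->
  orbit_closure mu nu.
Proof.
move=> nov KH low off.
pose c i j k := (K *m mul mu (H *m delta_mx i 0) (H *m delta_mx j 0)) k 0.
(* The truncated subtraction is harmless: the coefficient is 0 when the exponent
   should be negative. *)
pose q (s : str_index) :=
  c s.1.1 s.1.2 s.2 *: 'X^(w s.1.1 + w s.1.2 - w s.2).
have q0 : nu = [ffun s => (q s).[0]].
  apply/ffunP => -[[i j] k]; rewrite ffunE /q /= hornerZ hornerXn expr0n subn_eq0.
  have [le|gt] := leqP; first by rewrite mulr1 -low.
  by rewrite mulr0 off // gtn_eqF.
rewrite q0; apply: limit_in_closure => [|t t0]; first by rewrite -q0.
pose g := diag_mx (\row_i t ^- w i) *m K.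
pose h := H *m diag_mx (\row_i t ^+ w i).
have gh : g *m h = 1%:M.
  rewrite /g /h mulmxA -(mulmxA _ K H) KH mulmx1 mulmx_diag -diag_const_mx.
  by congr diag_mx; apply/rowP => i; rewrite !mxE mulVf // expf_neq0.
have [ug _] := mulmx1_unit gh.
have hg : invmx g = h by rewrite -[LHS]mulmx1 -gh mulKmx.
exists g => //; apply/ffunP => -[[i j] k]; rewrite !ffunE hg /=.
have hd l : h *m delta_mx l 0 = t ^+ w l *: (H *m delta_mx l 0 : 'cV_3).
  rewrite /h -mulmxA scalemxAr; congr (_ *m _).
  apply/colP => m; rewrite mul_diag_mx !mxE.
  by case: eqP => [->|]; rewrite ?mulr0.
rewrite !hd mulZ -scalemxAr /g -mulmxA mul_diag_mx mxE [X in _ * X]mxE mxE.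
rewrite /q /= hornerZ hornerXn -/(c i j k) -exprD.
have [le|gt] := leqP (w k) (w i + w j).
  by rewrite -{2}(subnK le) exprD; field; rewrite expf_neq0.
have -> : c i j k = 0.
  have -> : c i j k = nu (i, j, k) by apply: low; exact: ltnW.
  by apply: off; rewrite ltn_eqF.
by rewrite mul0r !mulr0.
Qed.

End Degenerations.

(** * Coordinates *)

Section Coordinates.
Variable F : fieldType.
Implicit Types (mu : structure F) (b x : 'cV[F]_3).

Lemma coord1_ord x (i : 'I_3) : coord1 x i.+1 = x i 0.
Proof. by rewrite /coord1 (eq_bigl (pred1 i)) ?big_pred1_eq. Qed.

Lemma delta_mxE (i : 'I_3) : delta_mx i 0 = e i.+1 :> 'cV[F]_3.
Proof. by apply/colP => k; rewrite !mxE andbT. Qed.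

Definition frame b1 b2 b3 : 'M[F]_3 :=
  \matrix_(i, j) nth 0 [:: b1; b2; b3] j i 0.

Lemma frame_mul b1 b2 b3 x :
  frame b1 b2 b3 *m x = coord1 x 1 *: b1 + coord1 x 2 *: b2 + coord1 x 3 *: b3.
Proof.
apply/colP => i; rewrite !mxE !big_ord_recl big_ord0 addr0 addrA !mxE.
rewrite -!coord1_ord /=.
by congr (_ + _ + _); rewrite mulrC.
Qed.

Lemma frame_det b1 b2 b3 : \det (frame b1 b2 b3) =
  coord1 b1 1 * (coord1 b2 2 * coord1 b3 3 - coord1 b2 3 * coord1 b3 2) -
  coord1 b2 1 * (coord1 b1 2 * coord1 b3 3 - coord1 b1 3 * coord1 b3 2) +
  coord1 b3 1 * (coord1 b1 2 * coord1 b2 3 - coord1 b1 3 * coord1 b2 2).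
Proof.
rewrite (expand_det_row _ 0) !big_ord_recl big_ord0 /cofactor.
rewrite !(expand_det_row _ 0) !big_ord_recl !big_ord0 /cofactor !det_mx11 !mxE /=.
rewrite -!coord1_ord /=.
rewrite /bump /= !(add0n, addn0, add1n, addn1, expr0, expr1, expr2); ring.
Qed.

Lemma rtrE mu x : rtr mu x =
  coord1 (mul mu (e 1) x) 1 + coord1 (mul mu (e 2) x) 2 +
  coord1 (mul mu (e 3) x) 3.
Proof.
rewrite /rtr /mxtrace !big_ord_recl big_ord0 addr0 addrA.
by rewrite ![rmx _ _ _ _]mxE !delta_mxE -!coord1_ord.
Qed.

Lemma outer_coord (u v : 'cV[F]_3) i j :
  (u *m v^T) i j = coord1 u i.+1 * coord1 v j.+1.
Proof. by rewrite mxE big_ord1 !mxE !coord1_ord. Qed.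

End Coordinates.

Definition coordE := (frame_mul, coord1_mul, big_cons, big_nil,
  coord1D, coord1N, coord1Z, coord1_0, coord1_e).

Section Limits.
Variable F : numFieldType.
Implicit Types (mu nu : structure F) (b x v : 'cV[F]_3).

(** The same statement for a basis given by its vectors, with entries read off by
[coord1] so that concrete multiplication tables can be evaluated. *)
Lemma graded_frame mu nu b1 b2 b3 (w : seq nat) :
  let H := frame b1 b2 b3 in let b := nth 0 [:: b1; b2; b3] in
  novikov nu -> \det H != 0 ->
  (forall i j k : 'I_3, (nth 0 w i + nth 0 w j <= nth 0 w k)%N ->
     coord1 (invmx H *m mul mu (b i) (b j)) k.+1 =
     coord1 (mul nu (e i.+1) (e j.+1)) k.+1) ->
  (forall i j k : 'I_3, (nth 0 w i + nth 0 w j != nth 0 w k)%N ->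
     coord1 (mul nu (e i.+1) (e j.+1)) k.+1 = 0) ->
  orbit_closure mu nu.
Proof.
move=> H b nov uH low off.
have nuE i j k : nu (i, j, k) = coord1 (mul nu (e i.+1) (e j.+1)) k.+1.
  by rewrite -mul_delta coord1_ord !delta_mxE.
have bE (i : 'I_3) : H *m delta_mx i 0 = b i.
  by apply/colP => k; rewrite -colE !mxE.
apply: (graded_in_closure (H := H) (K := invmx H)
          (w := fun i => nth 0%N w i)) => //.
- by rewrite mulVmx // unitmxE unitfE.
- by move=> i j k le; rewrite nuE -low // !bE coord1_ord.
- by move=> i j k ne; rewrite nuE off.
Qed.

Definition in_plane b b' v : Prop := exists s t, v = s *: b + t *: b'.

Lemma frame_coords b1 b2 b3 x r s t : \det (frame b1 b2 b3) != 0 ->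
  x = r *: b1 + s *: b2 + t *: b3 ->
  let y := invmx (frame b1 b2 b3) *m x in
  [/\ coord1 y 1 = r, coord1 y 2 = s & coord1 y 3 = t].
Proof.
move=> uH -> /=; pose y : 'cV[F]_3 := r *: e 1 + s *: e 2 + t *: e 3.
have [y1 y2 y3] : [/\ coord1 y 1 = r, coord1 y 2 = s & coord1 y 3 = t].
  by split; rewrite !coordE /=; ring.
have -> : r *: b1 + s *: b2 + t *: b3 = frame b1 b2 b3 *m y.
  by rewrite frame_mul y1 y2 y3.
by rewrite mulKmx // unitmxE unitfE.
Qed.

Lemma A1_limit mu : orbit_closure mu (A F 1).
Proof.
apply: (@graded_frame _ _ (e 1) (e 2) (e 3) [:: 1; 1; 1]%N).
- exact: A_novikov.
- rewrite frame_det !coordE /= (_ : _ + _ = 1) ?oner_neq0 //; ring.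
- by do 3!case=> [[|[|[|//]]] ?].
- by move=> i j k _; rewrite !coordE.
Qed.

Ltac graded_entries :=
  do 3!case=> [[|[|[|//]]] ?]; try (by []); move=> _; rewrite /=.

(** With weights (2, 1, 2) every product has weight at least 2, so no negative
exponent can occur, and only the part of b2 b2 outside the line of b2 has
exponent 0. *)
Lemma A5_limit mu b1 b2 b3 s : \det (frame b1 b2 b3) != 0 ->
  mul mu b2 b2 = b1 + s *: b2 -> orbit_closure mu (A F 5).
Proof.
move=> uH b22.
have [c1 _ c3] := frame_coords (x := mul mu b2 b2) (r := 1) (s := s) (t := 0)
  uH ltac:(by rewrite b22 scale1r scale0r addr0).
apply: (@graded_frame _ _ b1 b2 b3 [:: 2; 1; 2]%N) => //.
- exact: A_novikov.
- by graded_entries; rewrite ?c1 ?c3 !coordE /=; ring.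
- by graded_entries; rewrite !coordE /=; ring.
Qed.

Lemma in_plane_coord b1 b2 b3 x r : \det (frame b1 b2 b3) != 0 ->
  in_plane b2 b3 (x - r *: b1) -> coord1 (invmx (frame b1 b2 b3) *m x) 1 = r.
Proof.
move=> uH [s [t /eqP]]; rewrite subr_eq => /eqP xE.
by have [] := frame_coords (x := x) (r := r) (s := s) (t := t) uH
  ltac:(by rewrite xE addrC addrA).
Qed.

(** With weights (2, 1, 1) the graded product is the bilinear form induced on the
plane of b2 and b3 with values in the quotient line. *)
Lemma A9_limit mu b1 b2 b3 : \det (frame b1 b2 b3) != 0 ->
  in_plane b2 b3 (mul mu b2 b2) -> in_plane b2 b3 (mul mu b3 b3) ->
  in_plane b2 b3 (mul mu b2 b3 - b1) -> in_plane b2 b3 (mul mu b3 b2 - b1) ->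
  orbit_closure mu (A F 9).
Proof.
move=> uH p22 p33 p23 p32; have pl := in_plane_coord uH.
apply: (@graded_frame _ _ b1 b2 b3 [:: 2; 1; 1]%N) => //.
- exact: A_novikov.
- graded_entries.
  + by rewrite (pl _ 0) ?scale0r ?subr0 // !coordE /=; ring.
  + by rewrite (pl _ 1) ?scale1r // !coordE /=; ring.
  + by rewrite (pl _ 1) ?scale1r // !coordE /=; ring.
  + by rewrite (pl _ 0) ?scale0r ?subr0 // !coordE /=; ring.
- by graded_entries; rewrite !coordE /=; ring.
Qed.

(** With weights (3, 2, 1) the flag is b3, then the plane of b2 and b3: products
matter only modulo vectors of smaller weight, and b3 b3 must stay in the
plane. *)
Lemma A10_limit mu b1 b2 b3 s : \det (frame b1 b2 b3) != 0 ->
  mul mu b3 b3 = b2 + s *: b3 ->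
  in_plane b2 b3 (mul mu b2 b3 - b1) -> in_plane b2 b3 (mul mu b3 b2 - b1) ->
  orbit_closure mu (A F 10).
Proof.
move=> uH b33 p23 p32; have pl := in_plane_coord uH.
have [c1 c2 _] := frame_coords (x := mul mu b3 b3) (r := 0) (s := 1) (t := s)
  uH ltac:(by rewrite b33 scale1r scale0r add0r).
apply: (@graded_frame _ _ b1 b2 b3 [:: 3; 2; 1]%N) => //.
- exact: A_novikov.
- graded_entries.
  + by rewrite (pl _ 1) ?scale1r // !coordE /=; ring.
  + by rewrite (pl _ 1) ?scale1r // !coordE /=; ring.
  + by rewrite c1 !coordE /=; ring.
  + by rewrite c2 !coordE /=; ring.
- by graded_entries; rewrite !coordE /=; ring.
Qed.

End Limits.

(** * Limits of the algebras of type E *)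

Section TypeELimits.
Variable F : numFieldType.
Implicit Types lambda alpha beta : F.

Ltac det_is v :=
  rewrite (_ : \det _ = v); last by rewrite frame_det !coordE /=; field.
Ltac product_tac := apply: coord1P; rewrite !coordE /=; field.
Ltac plane s t := exists s, t; product_tac.

(** Here v = e_1 + e_2 has v^2 = alpha v + (alpha + 1) e_2. *)
Lemma E1_A5 lambda alpha : alpha != -1 -> orbit_closure (E1 lambda alpha) (A F 5).
Proof.
rewrite -addr_eq0 => ne.
apply: (@A5_limit _ _ ((alpha + 1) *: e 2) (e 1 + e 2) (e 3) alpha).
  by det_is (- (alpha + 1)); rewrite oppr_eq0.
by product_tac.
Qed.

(** For alpha = -1 the square of e_1 + e_2 is proportional to it, and e_3 replaces
e_2: for v = e_1 + e_3, v^2 = - v + (lambda - 1) e_3. *)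
Lemma E1N1_A5 lambda : lambda != 1 -> orbit_closure (E1 lambda (-1)) (A F 5).
Proof.
rewrite -subr_eq0 => ne.
apply: (@A5_limit _ _ ((lambda - 1) *: e 3) (e 1 + e 3) (e 2) (-1)).
  by det_is (lambda - 1).
by product_tac.
Qed.

Lemma E2_A5 lambda : orbit_closure (E2 lambda) (A F 5).
Proof.
apply: (@A5_limit _ _ (e 2) (e 1) (e 3) (-1)); last by product_tac.
by det_is (-1 : F); rewrite oppr_eq0 oner_neq0.
Qed.

Lemma E3_A5 : orbit_closure (E3 F) (A F 5).
Proof.
apply: (@A5_limit _ _ (e 3) (e 1) (e 2) (- (1 / 2))); last by product_tac.
by det_is (1 : F); rewrite oner_neq0.
Qed.

Lemma E4_A5 : orbit_closure (E4 F) (A F 5).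
Proof.
apply: (@A5_limit _ _ (e 2) (e 1) (e 3) (-1)); last by product_tac.
by det_is (-1 : F); rewrite oppr_eq0 oner_neq0.
Qed.

Lemma E5_A5 beta : orbit_closure (E5 beta) (A F 5).
Proof.
apply: (@A5_limit _ _ (e 2) (e 3) (e 1) 0); last by product_tac.
by det_is (1 : F); rewrite oner_neq0.
Qed.

Lemma E6_A5 : orbit_closure (E6 F) (A F 5).
Proof.
apply: (@A5_limit _ _ (2 *: e 2) (e 1 + e 3) (e 3) (- (1 / 2))).
  by det_is (- 2 : F); rewrite oppr_eq0 pnatr_eq0.
by product_tac.
Qed.

Lemma E3_A9 : orbit_closure (E3 F) (A F 9).
Proof.
apply: (@A9_limit _ _ (e 2) (e 1) (e 3)).
- by det_is (-1 : F); rewrite oppr_eq0 oner_neq0.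
- by plane (- (1 / 2) : F) (1 : F).
- by plane (0 : F) (0 : F).
- by plane (0 : F) (0 : F).
- by plane (0 : F) (- (1 / 2) : F).
Qed.

Lemma E6_A9 : orbit_closure (E6 F) (A F 9).
Proof.
apply: (@A9_limit _ _ (e 2) (e 1) (e 3)).
- by det_is (-1 : F); rewrite oppr_eq0 oner_neq0.
- by plane (- (1 / 2) : F) (0 : F).
- by plane (0 : F) (0 : F).
- by plane (0 : F) (0 : F).
- by plane (0 : F) (- (1 / 2) : F).
Qed.

(** On the plane of u = e_1 + a e_2 and e_3, the form is diagonal with values
a (beta + 1) and 1.  Here a makes the first value -1, so that u + e_3 and
u - e_3 are isotropic. *)
Lemma E5_A9 beta : beta != -1 -> orbit_closure (E5 beta) (A F 9).
Proof.
rewrite -addr_eq0 => ne; pose u : 'cV[F]_3 := e 1 - (beta + 1)^-1 *: e 2.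
apply: (@A9_limit _ _ ((- 2) *: e 2) (u + e 3) (u - e 3)); rewrite /u.
- by det_is (- 4 : F); rewrite oppr_eq0 pnatr_eq0.
- by plane ((3 * beta + 1 / 2) / 2) (- (beta + 1 / 2) / 2).
- by plane (- (beta + 1 / 2) / 2) ((3 * beta + 1 / 2) / 2).
- by plane ((beta - 1 / 2) / 2) ((beta + 1 / 2) / 2).
- by plane ((beta + 1 / 2) / 2) ((beta - 1 / 2) / 2).
Qed.

Lemma E3_A10 : orbit_closure (E3 F) (A F 10).
Proof.
apply: (@A10_limit _ _ (e 2) (e 3) (e 1) (- (1 / 2))).
- by det_is (1 : F); rewrite oner_neq0.
- by product_tac.
- by plane (- (1 / 2) : F) (0 : F).
- by plane (0 : F) (0 : F).
Qed.

(** For v = u + e_3, isotropic, v^2 - beta v = (beta + 1 / 2) e_3: the exclusion of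
beta = - 1 / 2 is the condition that v and v^2 span the plane. *)
Lemma E5_A10 beta : beta != - (1 / 2) -> beta != -1 ->
  orbit_closure (E5 beta) (A F 10).
Proof.
rewrite -addr_eq0 => ne2; rewrite -addr_eq0 => ne.
pose u : 'cV[F]_3 := e 1 - (beta + 1)^-1 *: e 2.
apply: (@A10_limit _ _ ((beta + 1 / 2) *: e 2) ((beta + 1 / 2) *: e 3) (u + e 3)
          beta); rewrite /u.
- by det_is ((beta + 1 / 2) ^+ 2); rewrite expf_neq0.
- by product_tac.
- by plane beta (0 : F).
- by plane (beta + 1 / 2) (0 : F).
Qed.

Ltac product_tacr hr := apply: coord1P; rewrite !coordE /=; field: hr.
Ltac planer hr s t := exists s, t; product_tacr hr.

(** On the plane of e_1 and e_3 the form is diagonal with both values 1, so the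
isotropic vectors involve a square root of -1. *)
Lemma E4_A9 (r : F) : r ^+ 2 = -1 -> orbit_closure (E4 F) (A F 9).
Proof.
move=> hr; have r0 : r != 0.
  by apply: contra_eq_neq hr => ->; rewrite expr0n eq_sym oppr_eq0 oner_neq0.
apply: (@A9_limit _ _ (2 *: e 2) (e 1 + r *: e 3) (e 1 - r *: e 3)).
- by det_is (4 * r); rewrite mulf_neq0 ?pnatr_eq0.
- by planer hr (- (5 / 4) : F) (1 / 4 : F).
- by planer hr (1 / 4 : F) (- (5 / 4) : F).
- by planer hr (- (3 / 4) : F) (- (1 / 4) : F).
- by planer hr (- (1 / 4) : F) (- (3 / 4) : F).
Qed.

(** The vector v = e_1 + r e_3 is isotropic, and v^2 + v = - (r / 2) e_3. *)
Lemma E4_A10 (r : F) : r ^+ 2 = -1 -> orbit_closure (E4 F) (A F 10).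
Proof.
move=> hr; have r0 : r != 0.
  by apply: contra_eq_neq hr => ->; rewrite expr0n eq_sym oppr_eq0 oner_neq0.
apply: (@A10_limit _ _ ((1 / 2) *: e 2) (- (r / 2) *: e 3) (e 1 + r *: e 3) (-1)).
- by det_is (- (r / 4)); rewrite oppr_eq0 mulf_neq0 ?invr_eq0 ?pnatr_eq0.
- by product_tacr hr.
- by planer hr (-1 : F) (0 : F).
- by planer hr (- (1 / 2) : F) (0 : F).
Qed.

End TypeELimits.
(** * Algebras that are not limits *)

Section Exclusions.
Variable F : numFieldType.
Implicit Types (mu nu : structure F) (lambda alpha beta : F).

(** The two features shared by all the algebras of type E: up to the constant c,
the weight by which ad acts on e_2 is the trace of the right multiplication. *)
Definition weight_vector (c : F) mu : Prop :=
  (forall x, rtr mu x = c * coord1 x 1) /\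
  (forall x, mul mu x (e 2) - mul mu (e 2) x = coord1 x 1 *: e 2).

Lemma e2_neq0 : e 2 != 0 :> 'cV[F]_3.
Proof.
apply/eqP => /(congr1 (fun v : 'cV[F]_3 => coord1 v 2)).
by rewrite coord1_e coord1_0 => /eqP; rewrite oner_eq0.
Qed.

Lemma weight_vector_cond c mu : weight_vector c mu -> weight_cond c mu.
Proof.
move=> [trE comE] x; apply/eqP; rewrite -det_tr; apply/det0P.
exists (e 2)^T; first by rewrite trmx_eq0 e2_neq0.
rewrite -trmx_mul mulmxBl -scalemxAl mulmxBl mul_lmx mul_rmx comE mul_scalar_mx.
by rewrite trE scalerA subrr trmx0.
Qed.

Lemma weight_vector_noncommutative c mu :
  weight_vector c mu -> ~ commutative_str mu.
Proof.
move=> [_ comE] com; have := comE (e 1).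
by rewrite com subrr coord1_e scale1r => /esym/eqP; rewrite (negPf e2_neq0).
Qed.

Ltac rtr_tac := rewrite rtrE !coordE /=; field.
Ltac weight_tac :=
  split=> x; [rtr_tac | apply: coord1P; rewrite !coordE /=; field].

Lemma E1_weight lambda alpha : weight_vector (3 * alpha) (E1 lambda alpha).
Proof. by weight_tac. Qed.

Lemma E2_weight lambda : weight_vector (- 3) (E2 lambda).
Proof. by weight_tac. Qed.

Lemma E3_weight : weight_vector (- (3 / 2)) (E3 F).
Proof. by weight_tac. Qed.

Lemma E4_weight : weight_vector (- 3) (E4 F).
Proof. by weight_tac. Qed.

Lemma E5_weight beta : weight_vector (3 * beta) (E5 beta).
Proof. by weight_tac. Qed.

Lemma E6_weight : weight_vector (- (3 / 2)) (E6 F).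
Proof. by weight_tac. Qed.

Lemma A_commutative j : commutative_str (A F j).
Proof.
move=> x y; apply: coord1P;
  by do 13?[case: j => [|j]; first by rewrite /A /= !coordE /=; ring];
    rewrite /A /= !coordE /=; ring.
Qed.

(** The other algebras contain an idempotent e_2 or e_3 whose right multiplication
has trace 1, 2 or 3. *)
Lemma A_rtr_eq0 j : (1 <= j <= 12)%N ->
  rtr (A F j) (e 2) = 0 -> rtr (A F j) (e 3) = 0 -> j \in [:: 1; 5; 9; 10]%N.
Proof.
have nz n : n.+1%:R = 0 :> F -> False by move/eqP; rewrite pnatr_eq0.
rewrite !rtrE; do 13?[case: j => [|j] //] => _; rewrite /A /= !coordE /= => t2 t3.
(* The traces are 1, 2 and 3, attained at e_3 except for A_7, where e_2 gives 2. *)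
all: try by case: (nz 0%N); apply: etrans t3; ring.
all: try by case: (nz 1%N); apply: etrans t2; ring.
all: try by case: (nz 2%N); apply: etrans t3; ring.
Qed.

Lemma boundary_candidates c mu j : weight_vector c mu -> (1 <= j <= 12)%N ->
  lies_in_boundary (A F j) mu -> j \in [:: 1; 5; 9; 10]%N.
Proof.
move=> /weight_vector_cond wmu hj lie.
have wA := boundary_closed (weight_cond_invariant (c := c))
             (weight_cond_closed c) wmu lie.
by apply: A_rtr_eq0 => //; apply: weight_cond_commutative wA; exact: A_commutative.
Qed.

Lemma rtr_nilpotent j x : j \in [:: 5; 9; 10]%N -> rtr (A F j) x = 0.
Proof.
by rewrite !inE rtrE => /or3P[]/eqP->; rewrite !coordE /=; ring.
Qed.

Lemma residual_nilpotent j x y : j \in [:: 5; 9; 10]%N ->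
  residual (A F j) x y = 3 *: mul (A F j) x y.
Proof. by move=> hj; rewrite /residual rtr_nilpotent // scale0r subr0. Qed.

Lemma exchange_coord l r mu x y z w (i j : 'I_3) : exchange l r mu ->
  coord1 (residual mu x y) i.+1 * coord1 (residual mu z w) j.+1 =
  coord1 (residual mu (if l then z else x) (if r then w else y)) i.+1 *
  coord1 (residual mu (if l then x else z) (if r then y else w)) j.+1.
Proof. by move=> ex; rewrite -!outer_coord ex. Qed.

(** Exchange e_3 and e_2 in the product of e_2 e_3 = e_1 with e_3 e_2 = e_1: on
either side this produces a factor e_2 e_2 = 0. *)
Lemma A9_A10_not_exchange l j : j \in [:: 9; 10]%N -> ~ exchange l (~~ l) (A F j).
Proof.
move=> hj ex.
have h5 : j \in [:: 5; 9; 10]%N by rewrite inE hj orbT.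
have := exchange_coord (e 2) (e 3) (e 3) (e 2) ord0 ord0 ex.
have nz : 9 != 0 :> F by rewrite pnatr_eq0.
rewrite !residual_nilpotent //; move: hj; rewrite !inE.
by case: (l) => /orP[]/eqP->; rewrite !coordE /= => H; case/eqP: nz;
  (transitivity (3 * 1 * (3 * 1) : F); first by ring);
  move: H; rewrite !(mulr0, mul0r, addr0, add0r, mulr1).
Qed.

(** The values e_2 e_3 = e_1 and e_3 e_3 = e_2 are not proportional. *)
Lemma A10_not_exchange : ~ exchange true true (A F 10).
Proof.
move=> ex.
have := exchange_coord (e 2) (e 3) (e 3) (e 3) ord0 (lift ord0 ord0) ex.
have nz : 9 != 0 :> F by rewrite pnatr_eq0.
rewrite !residual_nilpotent // !coordE /= => H; case/eqP: nz.
transitivity (3 * 1 * (3 * 1) : F); first by ring.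
by move: H; rewrite !(mulr0, mul0r, addr0, add0r, mulr1).
Qed.

Lemma nilpotent_not_residual_free j : j \in [:: 5; 9; 10]%N ->
  ~ residual_free (A F j).
Proof.
move=> hj fr.
have nz : 3 != 0 :> F by rewrite pnatr_eq0.
have := congr1 (fun v : 'cV[F]_3 => coord1 v 1) (fr (e 2) (e 2)).
have := congr1 (fun v : 'cV[F]_3 => coord1 v 1) (fr (e 2) (e 3)).
rewrite !residual_nilpotent //; move: hj; rewrite !inE.
by case/or3P=> /eqP->; rewrite !coordE /= => H1 H2; case/eqP: nz;
  (apply: etrans H2; ring) || (apply: etrans H1; ring).
Qed.

Lemma outerZ a b (u v : 'cV[F]_3) :
  (a *: u) *m (b *: v)^T = (a * b) *: (u *m v^T).
Proof. by rewrite linearZ /= -scalemxAl -scalemxAr scalerA. Qed.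

Lemma exchange_left mu (f : 'cV[F]_3 -> F) (B : 'cV[F]_3 -> 'cV[F]_3) :
  (forall x y, residual mu x y = f x *: B y) -> exchange true false mu.
Proof.
by move=> fac x y z w; rewrite !fac !outerZ /= mulrC.
Qed.

Lemma exchange_right mu (f : 'cV[F]_3 -> F) (B : 'cV[F]_3 -> 'cV[F]_3) :
  (forall x y, residual mu x y = f y *: B x) -> exchange false true mu.
Proof.
by move=> fac x y z w; rewrite !fac !outerZ /= mulrC.
Qed.

Lemma exchange_both mu (f : 'cV[F]_3 -> 'cV[F]_3 -> F) (u : 'cV[F]_3) :
  (forall x y, residual mu x y = f x y *: u) -> exchange true true mu.
Proof.
by move=> fac x y z w; rewrite !fac !outerZ /= mulrC.
Qed.

Ltac residual_tac :=
  apply: coord1P; rewrite /residual rtrE !coordE /=; field.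

Lemma E1_exchange lambda alpha : exchange true false (E1 lambda alpha).
Proof.
apply: (exchange_left (f := fun x => 3 * coord1 x 1) (B := fun y =>
  ((alpha + 1) * coord1 y 2) *: e 2 + ((alpha + lambda) * coord1 y 3) *: e 3)).
by move=> x y; residual_tac.
Qed.

Lemma E2_exchange lambda : exchange true false (E2 lambda).
Proof.
apply: (exchange_left (f := fun x => 3 * coord1 x 1) (B := fun y =>
  coord1 y 1 *: e 2 + ((lambda - 1) * coord1 y 3) *: e 3)).
by move=> x y; residual_tac.
Qed.

Lemma E5N1_exchange : exchange false true (E5 (-1 : F)).
Proof.
apply: (exchange_right (f := fun y => 3 * coord1 y 3) (B := fun x =>
  coord1 x 3 *: e 2 - (1 / 2 * coord1 x 1) *: e 3)).
by move=> x y; residual_tac.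
Qed.

Lemma E5Nhalf_exchange : exchange true true (E5 (- (1 / 2) : F)).
Proof.
apply: (exchange_both (f := fun x y => 3 * (1 / 2 * coord1 x 1 * coord1 y 2 +
  coord1 x 3 * coord1 y 3)) (u := e 2)).
by move=> x y; residual_tac.
Qed.

Lemma E6_exchange : exchange true true (E6 F).
Proof.
apply: (exchange_both (f := fun x y => 3 * (1 / 2 * coord1 x 1 * coord1 y 2 +
  coord1 x 1 * coord1 y 3 + coord1 x 3 * coord1 y 1)) (u := e 2)).
by move=> x y; residual_tac.
Qed.

Lemma E11_residual_free : residual_free (E1 1 (-1 : F)).
Proof. by move=> x y; residual_tac. Qed.

Lemma boundary_exchange l r mu nu : exchange l r mu ->
  lies_in_boundary nu mu -> exchange l r nu.
Proof.
move=> ex; apply: boundary_closed ex; [exact: exchange_invariant | exact: exchange_closed].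
Qed.

(** The orbit of a noncommutative algebra contains no commutative one. *)
Lemma closure_boundary c mu j : weight_vector c mu -> (1 <= j <= 12)%N ->
  orbit_closure mu (A F j) -> lies_in_boundary (A F j) mu.
Proof.
move=> wmu hj clo; exists (A F j); first exact: orbit_refl.
split=> // -[g ug AE]; apply: (weight_vector_noncommutative wmu).
rewrite -(gactK mu ug) -AE; apply: commutative_invariant; last exact: A_commutative.
by rewrite unitmx_inv.
Qed.

End Exclusions.
(** * The boundaries *)

Section Boundaries.
Variable F : numFieldType.
Implicit Types (mu : structure F) (lambda alpha beta : F) (j k : nat).

(** Once the trace has reduced the candidates to four, each algebra of type E only
requires the degenerations that exist and the exclusion of the rest of the
four. *)
Lemma boundary_iff c mu (L : seq nat) j : weight_vector c mu ->
  (1 <= j <= 12)%N ->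
  (forall k, k \in L -> orbit_closure mu (A F k)) ->
  (forall k, k \in [:: 1; 5; 9; 10]%N -> k \notin L ->
     ~ lies_in_boundary (A F k) mu) ->
  lies_in_boundary (A F j) mu <-> j \in L.
Proof.
move=> wmu hj inL notL; split=> [lie|jL]; last exact: (closure_boundary wmu hj (inL _ jL)).
by apply: contraT => jL; case: (notL j _ jL lie); exact: (boundary_candidates wmu hj lie).
Qed.

Ltac each_limit := move=> k; rewrite !inE;
  do ?[case/orP]; move/eqP=> ->; try exact: A1_limit.
Ltac each_other := move=> k; rewrite !inE; case/or4P=> /eqP-> //= _.

Lemma not_in_boundary_exchange l mu k : k \in [:: 9; 10]%N ->
  exchange l (~~ l) mu -> ~ lies_in_boundary (A F k) mu.
Proof.
by move=> hk ex /(boundary_exchange ex); exact: A9_A10_not_exchange.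
Qed.

Lemma A10_not_in_boundary mu :
  exchange true true mu -> ~ lies_in_boundary (A F 10) mu.
Proof. by move=> ex /(boundary_exchange ex); exact: A10_not_exchange. Qed.

Lemma E1_boundary lambda alpha j : (1 <= j <= 12)%N -> alpha != -1 ->
  lies_in_boundary (A F j) (E1 lambda alpha) <-> j \in [:: 1; 5]%N.
Proof.
move=> hj ne; apply: (boundary_iff (E1_weight _ _) hj).
  by each_limit; exact: E1_A5.
by each_other; apply: not_in_boundary_exchange (E1_exchange _ _).
Qed.

Lemma E1N1_boundary lambda j : (1 <= j <= 12)%N -> lambda != 1 ->
  lies_in_boundary (A F j) (E1 lambda (-1)) <-> j \in [:: 1; 5]%N.
Proof.
move=> hj ne; apply: (boundary_iff (E1_weight _ _) hj).
  by each_limit; exact: E1N1_A5.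
by each_other; apply: not_in_boundary_exchange (E1_exchange _ _).
Qed.

Lemma E11_boundary j : (1 <= j <= 12)%N ->
  lies_in_boundary (A F j) (E1 1 (-1)) <-> j \in [:: 1]%N.
Proof.
move=> hj; apply: (boundary_iff (E1_weight _ _) hj); first by each_limit.
have excl k : k \in [:: 5; 9; 10]%N -> ~ lies_in_boundary (A F k) (E1 1 (-1)).
  move=> hk lie; apply: (nilpotent_not_residual_free (F := F) hk).
  exact: (boundary_closed (residual_free_invariant (F := F)) (residual_free_closed F)
            (@E11_residual_free F) lie).
by each_other; exact: excl.
Qed.

Lemma E2_boundary lambda j : (1 <= j <= 12)%N ->
  lies_in_boundary (A F j) (E2 lambda) <-> j \in [:: 1; 5]%N.
Proof.
move=> hj; apply: (boundary_iff (E2_weight _) hj).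
  by each_limit; exact: E2_A5.
by each_other; apply: not_in_boundary_exchange (E2_exchange _).
Qed.

Lemma E3_boundary j : (1 <= j <= 12)%N ->
  lies_in_boundary (A F j) (E3 F) <-> j \in [:: 1; 5; 9; 10]%N.
Proof.
move=> hj; apply: (boundary_iff (E3_weight F) hj); last by each_other.
by each_limit; [exact: E3_A5 | exact: E3_A9 | exact: E3_A10].
Qed.

Lemma E4_boundary (r : F) j : r ^+ 2 = -1 -> (1 <= j <= 12)%N ->
  lies_in_boundary (A F j) (E4 F) <-> j \in [:: 1; 5; 9; 10]%N.
Proof.
move=> hr hj; apply: (boundary_iff (E4_weight F) hj); last by each_other.
by each_limit; [exact: E4_A5 | exact: E4_A9 hr | exact: E4_A10 hr].
Qed.

Lemma E5_boundary beta j : (1 <= j <= 12)%N -> beta != - (1 / 2) -> beta != -1 ->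
  lies_in_boundary (A F j) (E5 beta) <-> j \in [:: 1; 5; 9; 10]%N.
Proof.
move=> hj ne2 ne; apply: (boundary_iff (E5_weight _) hj); last by each_other.
by each_limit; [exact: E5_A5 | exact: E5_A9 | exact: E5_A10].
Qed.

Lemma E5Nhalf_boundary j : (1 <= j <= 12)%N ->
  lies_in_boundary (A F j) (E5 (- (1 / 2))) <-> j \in [:: 1; 5; 9]%N.
Proof.
move=> hj; apply: (boundary_iff (E5_weight _) hj).
  each_limit; [exact: E5_A5 | apply: E5_A9].
  rewrite eqr_opp -subr_eq0 (_ : _ - _ = - (1 / 2)); last by field.
  by rewrite oppr_eq0 mul1r invr_eq0 pnatr_eq0.
by each_other; apply: A10_not_in_boundary; exact: E5Nhalf_exchange.
Qed.

Lemma E5N1_boundary j : (1 <= j <= 12)%N ->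
  lies_in_boundary (A F j) (E5 (-1)) <-> j \in [:: 1; 5]%N.
Proof.
move=> hj; apply: (boundary_iff (E5_weight _) hj).
  by each_limit; exact: E5_A5.
by each_other; apply: not_in_boundary_exchange (@E5N1_exchange F).
Qed.

Lemma E6_boundary j : (1 <= j <= 12)%N ->
  lies_in_boundary (A F j) (E6 F) <-> j \in [:: 1; 5; 9]%N.
Proof.
move=> hj; apply: (boundary_iff (E6_weight F) hj).
  by each_limit; [exact: E6_A5 | exact: E6_A9].
by each_other; apply: A10_not_in_boundary; exact: E6_exchange.
Qed.

End Boundaries.

Theorem proposition4p10 (R : realType) (j : nat) (hj : (1 <= j <= 12)%N) :
  (forall lambda alpha : R[i], lambda != 0 -> alpha != -1 ->
     lies_in_boundary (A R[i] j) (E1 lambda alpha) <-> j \in [:: 1; 5]%N) /\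
  (forall lambda : R[i], lambda != 0 -> lambda != 1 ->
     lies_in_boundary (A R[i] j) (E1 lambda (-1)) <-> j \in [:: 1; 5]%N) /\
  (lies_in_boundary (A R[i] j) (E1 1 (-1)) <-> j \in [:: 1]%N) /\
  (forall lambda : R[i], lambda != 0 ->
     lies_in_boundary (A R[i] j) (E2 lambda) <-> j \in [:: 1; 5]%N) /\
  (lies_in_boundary (A R[i] j) (E3 R[i]) <-> j \in [:: 1; 5; 9; 10]%N) /\
  (lies_in_boundary (A R[i] j) (E4 R[i]) <-> j \in [:: 1; 5; 9; 10]%N) /\
  (forall beta : R[i], beta != - (1 / 2) -> beta != -1 ->
     lies_in_boundary (A R[i] j) (E5 beta) <-> j \in [:: 1; 5; 9; 10]%N) /\
  (lies_in_boundary (A R[i] j) (E5 (- (1 / 2))) <-> j \in [:: 1; 5; 9]%N) /\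
  (lies_in_boundary (A R[i] j) (E5 (-1)) <-> j \in [:: 1; 5]%N) /\
  (lies_in_boundary (A R[i] j) (E6 R[i]) <-> j \in [:: 1; 5; 9]%N).
Proof.
split; first by move=> lambda alpha _; exact: E1_boundary.
split; first by move=> lambda _; exact: E1N1_boundary.
split; first exact: E11_boundary.
split; first by move=> lambda _; exact: E2_boundary.
split; first exact: E3_boundary.
split; first exact: (E4_boundary (sqr_i R)).
split; first by move=> beta; exact: E5_boundary.
split; first exact: E5Nhalf_boundary.
split; first exact: E5N1_boundary.
exact: E6_boundary.
Qed.
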